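(* Suppose that for some $n \geq 0$ the block $s(n), s(n+1), \ldots, s(n+2p+q-1)$ of $2p+q$ consecutive terms of the infinity series has the form $xyx$, where $x$ is a block of length $p \geq 1$ and $y$ is a block of length $q \geq 0$ (i.e., $s(n+t) = s(n+p+q+t)$ for all $0 \leq t < p$). Then $q \geq 2p$. In particular, the infinity series contains no two consecutive identical nonempty blocks.
   Context: The infinity series $(s(n))_{n \geq 0}$ is the integer sequence defined by $s(0)=0$, $s(2n) = -s(n)$ for $n \geq 1$, and $s(2n+1) = s(n)+1$ for $n \geq 0$. A block is a finite list of consecutive terms of the sequence; $xyx$ denotes concatenation of blocks, and $|x|$ is the length of $x$. *)

(* Defs.v *)
From mathcomp Require Import all_boot all_order all_algebra.
Set Implicit Arguments.
Unset Strict Implicit.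
Unset Printing Implicit Defensive.
Import GRing.Theory.

(* The recursion n |-> n./2 is not structural, so it is driven by a fuel [k];
   any [k >= n] gives the same value (infser_rec_fuel). *)
Fixpoint infser_rec (k n : nat) {struct k} : int :=
  if k is k'.+1 then
    if n == 0 then 0%R
    else if odd n then (infser_rec k' n./2 + 1)%R
    else (- infser_rec k' n./2)%R
  else 0%R.

(* The infinity series; its defining equations are infser0, infser_even and
   infser_odd, and infser_unique shows that they determine it. *)
Definition infser (n : nat) : int := infser_rec n n.

Definition block (n l : nat) : seq int := mkseq (fun t => infser (n + t)) l.

Lemma infser_rec_fuel (k n : nat) : n <= k -> infser_rec k n = infser n.
Proof.
rewrite /infser; elim/ltn_ind: k n => -[|k] IHk [|n] //= le_nk.
have lt_half : uphalf n <= n by rewrite leq_uphalf_double -addnn leq_addr.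
have le_nk' : uphalf n <= k by apply: leq_trans lt_half _.
have E : infser_rec k (uphalf n) = infser_rec n (uphalf n).
  by rewrite (IHk k) // (IHk n).
by rewrite E.
Qed.

Lemma infser0 : infser 0 = 0%R.
Proof. by []. Qed.

Lemma infserS (n : nat) :
  infser n.+1 = if odd n.+1 then (infser n.+1./2 + 1)%R else (- infser n.+1./2)%R.
Proof.
rewrite -(@infser_rec_fuel n n.+1./2) //.
by rewrite leq_uphalf_double -addnn leq_addr.
Qed.

Lemma infser_even (n : nat) : 1 <= n -> infser (2 * n) = (- infser n)%R.
Proof.
by case: n => // n _; rewrite mul2n doubleS infserS -doubleS odd_double doubleK.
Qed.

Lemma infser_odd (n : nat) : infser (2 * n + 1) = (infser n + 1)%R.
Proof. by rewrite mul2n addn1 infserS oddS odd_double /= uphalf_double. Qed.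

Lemma infser_unique (s : nat -> int) :
  s 0 = 0%R ->
  (forall n, 1 <= n -> s (2 * n) = (- s n)%R) ->
  (forall n, s (2 * n + 1) = (s n + 1)%R) ->
  s =1 infser.
Proof.
move=> s0 s_even s_odd; elim/ltn_ind=> n IHn.
have := odd_double_half n; rewrite -mul2n.
case: (odd n) => /= def_n.
  have lt_n : n./2 < n by rewrite -{2}def_n mul2n -addnn add1n ltnS leq_addr.
  by rewrite -def_n addnC s_odd infser_odd IHn.
case: (posnP n./2) def_n => [-> <- // | n_gt0] def_n.
have lt_n : n./2 < n.
  by rewrite -{2}def_n add0n mul2n -addnn -[ltnLHS]addn0 ltn_add2l.
by rewrite -def_n add0n s_even // infser_even // IHn.
Qed.

(* Main.v *)
Require Import Defs.
From mathcomp Require Import all_boot all_order all_algebra.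
From mathcomp Require Import zify.

(** Write the hypothesis as s(m) = s(m + d) for n <= m < n + p, with d = p + q;
    the claim is 3p <= d. For d = 2e the recursion turns such a run into a run of
    length at least p / 2 for the shift e. For d odd, two consecutive agreements
    force s(k) = s(k + 1) for some k, which never happens, so p <= 1; and p = 0
    when d = 1 for the same reason. *)

Lemma infser_double (n : nat) : infser (2 * n) = (- infser n)%R.
Proof. by case: (posnP n) => [-> | /infser_even]. Qed.

(* With D(k) = s(k + 1) - s(k) and S(k) = s(k) + s(k + 1), the recursion gives
   D(2k + 1) = - S(k) - 1 and S(2k + 1) = 1 - D(k), so that only the two
   conditions together, with j arbitrary, are inductive. *)
Lemma infser_consecutive (k j : nat) :
  (infser k.+1 - infser k)%R <> Posz (2 * j) /\
  (infser k + infser k.+1)%R <> (- Posz (2 * j).+1)%R.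
Proof.
elim/ltn_ind: k j => k IHk j.
have [m [] def_k] : exists m, k = 2 * m \/ k = 2 * m + 1.
  by exists k./2; lia.
(* For [k] even the difference is odd and the sum is 1. *)
- have -> : k.+1 = 2 * m + 1 by lia.
  by rewrite def_k infser_odd infser_double; lia.
have -> : k.+1 = 2 * m.+1 by lia.
have lt_mk : m < k by lia.
have [_ neS] := IHk m lt_mk j; have [neD _] := IHk m lt_mk j.+1.
by rewrite def_k infser_odd infser_double; lia.
Qed.

Lemma infser_neqS (k : nat) : infser k <> infser k.+1.
Proof. by have [] := infser_consecutive k 0; lia. Qed.

(** Each agreement pairs an even index with an odd one; eliminating the term common to both leaves
    equal values at [m + e], [(m + e).+1] or at [m], [m.+1]. *)
Lemma infser_odd_shift (n e : nat) :
  infser n = infser (n + (2 * e).+1) ->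
  infser n.+1 <> infser (n.+1 + (2 * e).+1).
Proof.
have [m [] ->] : exists m, n = 2 * m \/ n = 2 * m + 1.
  by exists n./2; lia.
- have -> : 2 * m + (2 * e).+1 = 2 * (m + e) + 1 by lia.
  have -> : (2 * m).+1 + (2 * e).+1 = 2 * (m + e).+1 by lia.
  have := infser_neqS (m + e).
  by rewrite -[(2 * m).+1]addn1 !infser_odd !infser_double; lia.
have -> : 2 * m + 1 + (2 * e).+1 = 2 * (m + e).+1 by lia.
have -> : (2 * m + 1).+1 + (2 * e).+1 = 2 * (m + e).+1 + 1 by lia.
have -> : (2 * m + 1).+1 = 2 * m.+1 by lia.
have := infser_neqS m.
by rewrite !infser_odd !infser_double; lia.
Qed.

(** An even shift keeps parity, and both branches of the recursion are injective. *)
Lemma infser_even_shift (n e : nat) :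
  infser n = infser (n + 2 * e) -> infser n./2 = infser (n./2 + e).
Proof.
have [m [] def_n] : exists m, n = 2 * m \/ n = 2 * m + 1.
  by exists n./2; lia.
- have -> : n + 2 * e = 2 * (m + e) by lia.
  have -> : n./2 = m by lia.
  by rewrite def_n !infser_double; lia.
have -> : n + 2 * e = 2 * (m + e) + 1 by lia.
have -> : n./2 = m by lia.
by rewrite def_n !infser_odd; lia.
Qed.

Lemma infser_run_bound (d n p : nat) :
  0 < d -> (forall t, t < p -> infser (n + t) = infser (n + t + d)) ->
  3 * p <= d.
Proof.
elim/ltn_ind: d n p => d IHd n p d_gt0 run.
have [e [] def_d] : exists e, d = 2 * e \/ d = (2 * e).+1.
  by exists d./2; lia.
- have lt_ed : e < d by lia.
  have e_gt0 : 0 < e by lia.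
  (* The offsets [2 * t < p] are those with [t < uphalf p]; rounding up keeps the bound sharp for
     odd [p]. *)
  suff: 3 * uphalf p <= e by lia.
  apply: (IHd e lt_ed n./2) => // t lt_t.
  have -> : n./2 + t = (n + 2 * t)./2 by lia.
  by apply: infser_even_shift; rewrite -def_d; apply: run; lia.
case: p run => [|[|p]] run; first by [].
(* As [d] is odd, only [d = 1] could break the bound for [p = 1]. *)
- case: e def_d => [|e] def_d; last by lia.
  have := run 0 isT.
  by rewrite def_d addn0 addn1 => /infser_neqS.
have /infser_odd_shift ne : infser n = infser (n + (2 * e).+1).
  by have := run 0 isT; rewrite addn0 def_d.
by case: ne; have := run 1 isT; rewrite addn1 def_d.
Qed.

Lemma nth_block (n l t : nat) :
  t < l -> nth 0%R (block n l) t = infser (n + t).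
Proof. by move=> lt_tl; rewrite nth_mkseq. Qed.

Theorem theorem10 :
  (forall (n p q : nat) (x y : seq int),
      1 <= p -> size x = p -> size y = q ->
      block n (2 * p + q) = x ++ y ++ x ->
      2 * p <= q)
  /\
  ~ (exists (n : nat) (x : seq int),
      x <> [::] /\ block n (2 * size x) = x ++ x).
Proof.
have gap (n p q : nat) (x y : seq int) :
    1 <= p -> size x = p -> size y = q ->
    block n (2 * p + q) = x ++ y ++ x -> 2 * p <= q.
  move=> p_gt0 size_x size_y eq_block.
  suff: 3 * p <= p + q by lia.
  apply: (@infser_run_bound _ n); first by lia.
  move=> t lt_tp.
  have lt1 : t < 2 * p + q by lia.
  have lt2 : t + (p + q) < 2 * p + q by lia.
  rewrite -addnA -(nth_block n _ _ lt1) -(nth_block n _ _ lt2) eq_block catA.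
  rewrite [RHS]nth_cat -catA nth_cat size_cat size_x size_y lt_tp.
  by rewrite ltnNge leq_addl addnK.
split=> // -[n [x [x_neq0 eq_block]]].
have size_gt0 : 0 < size x by case: x x_neq0 {eq_block}.
have := gap n (size x) 0 x [::] size_gt0 erefl erefl.
by rewrite addn0 => /(_ eq_block); lia.
Qed.
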